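(* For all integers $n\ge k\ge 2$ and $r>s\ge 1$, $$A_k(n;r,s)\le m_k\!\left(n;\tbinom{r}{s},\tbinom{r-1}{s-1}\right)+1.$$ Moreover, when $s\in\{1,r-1\}$, also $A_k(n;r,s)> m_k\!\left(n;\tbinom{r}{s},\tbinom{r-1}{s-1}\right)$.
   Context: For a natural number $N$, $[N]=\{1,\dots,N\}$ and $[N]^{(k)}$ denotes the set of $k$-element subsets of $[N]$. A tight monotone path of length $n$ (on $n$ edges) in a $k$-uniform hypergraph on $[N]$ is determined by vertices $v_1<\dots<v_{n+k-1}$ and consists of the $n$ edges $\{v_i,\dots,v_{i+k-1}\}$, $1\le i\le n$. For positive integers $n\ge k$ and $r>s$, $A_k(n;r,s)$ is the least $N$ such that every coloring of $[N]^{(k)}$ with $r$ colors contains a tight monotone path on $n$ edges using at most $s$ distinct colors. Generalized $S$-increasing sequences: let $S<R$ and $n$ be positive integers. For $\vec x=(x_1,\dots,x_R),\vec y=(y_1,\dots,y_R)\in[n]^R$, write $\vec x<^{(2)}_S\vec y$ if $x_\ell<y_\ell$ for at least $S$ coordinates $\ell\in[R]$. Let $\mathcal P^{(0)}([n]^R)=[n]^R$ and $\mathcal P^{(j)}([n]^R)=\mathcal P(\mathcal P^{(j-1)}([n]^R))$ (the $j$-fold power set). Recursively, given a relation $<^{(k)}_S$ on $\mathcal P^{(k-2)}([n]^R)$ ($k\ge2$), define $<^{(k+1)}_S$ on $\mathcal P^{(k-1)}([n]^R)$ by: $\mathcal F<^{(k+1)}_S\mathcal F'$ if there exists an element $F'\in\mathcal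 F'$ such that $F<^{(k)}_S F'$ for all $F\in\mathcal F$. For $k\ge 2$, a finite sequence $(\mathcal F_i)$ of elements of $\mathcal P^{(k-2)}([n]^R)$ is $S$-increasing if $\mathcal F_i<^{(k)}_S\mathcal F_j$ for all $i<j$; $m_k(n;R,S)$ denotes the maximum length of an $S$-increasing sequence in $\mathcal P^{(k-2)}([n]^R)$. *)

(* Defs.v *)
From mathcomp Require Import all_boot.

Set Implicit Arguments.
Unset Strict Implicit.
Unset Printing Implicit Defensive.

(** * Tight monotone paths

    The vertex set [N] is ['I_N]; only the order of the vertices matters, so
    they are numbered from 0. *)

(* The vertices v_0 < v_1 < ... of the path are the values of [v]. *)
Definition tight_path_edges (k n N : nat) (v : 'I_(n + k - 1) -> 'I_N) :
    {set {set 'I_N}} :=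
  [set [set v j | j : 'I_(n + k - 1) & i <= j < i + k] | i : 'I_n].

Lemma card_tight_edge k n N (v : 'I_(n + k - 1) -> 'I_N) e :
  (forall i j : 'I_(n + k - 1), i < j -> v i < v j) ->
  e \in tight_path_edges v -> #|e| = k.
Proof.
move=> v_mono /imsetP[i _ ->]; rewrite card_in_imset; last first.
  move=> a b _ _ eq_v; apply/val_inj/eqP.
  by case: ltngtP (eq_v) => // /v_mono; rewrite eq_v ltnn.
case: k => [|k] in v v_mono *.
  by apply: eq_card0 => j; rewrite !inE (addn0 (i : nat)) ltnNge andbN.
have lt_ij (j : 'I_k.+1) : i + j < n + k.+1 - 1.
  by rewrite addnS subn1 -addSn leq_add // -ltnS.
rewrite -[RHS]card_ord -(@card_imset _ _ (fun j => Ordinal (lt_ij j))).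
  apply: eq_card => j; rewrite !inE; apply/andP/imsetP => [[le_ij lt_jk]|].
    have lt_j : j - i < k.+1 by rewrite ltn_subLR.
    by exists (Ordinal lt_j) => //; apply: val_inj; rewrite /= subnKC.
  by case=> a _ -> /=; rewrite leq_addr ltn_add2l.
by move=> a b [] /addnI /val_inj.
Qed.

(* A coloring is given on all subsets of the vertex set, but only its values
   on [k]-element subsets are ever used: the edges of a tight path with
   increasing vertices all have exactly [k] elements ([card_tight_edge]). *)
Definition forces_path (k n r s N : nat) : Prop :=
  forall c : {set 'I_N} -> 'I_r,
  exists v : 'I_(n + k - 1) -> 'I_N,
    (forall i j : 'I_(n + k - 1), i < j -> v i < v j) /\
    #|[set c e | e in tight_path_edges v]| <= s.

(* [is_A k n r s N] says that A_k(n; r, s) exists and equals [N]. *)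
Definition is_A (k n r s N : nat) : Prop :=
  forces_path k n r s N /\ forall M, forces_path k n r s M -> N <= M.

Lemma is_A_unique k n r s N M : is_A k n r s N -> is_A k n r s M -> N = M.
Proof.
by move=> [fN minN] [fM minM]; apply/eqP; rewrite eqn_leq minN // minM.
Qed.

(** * Generalized S-increasing sequences *)

Fixpoint iter_powerset (T : finType) (j : nat) : finType :=
  if j is j'.+1 then {set iter_powerset T j'} : finType else T.

(* [n]^R, with the coordinates and their values numbered from 0. *)
Notation grid n R := {ffun 'I_R -> 'I_n}.

(* [ltS n R S j] is the relation with superscript (j + 2), on the j-fold
   power set of [n]^R. *)
Fixpoint ltS (n R S j : nat) : rel (iter_powerset (grid n R) j) :=
  match j return rel (iter_powerset (grid n R) j) with
  | 0 => fun x y : grid n R => S <= #|[set l | x l < y l]|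
  | j'.+1 => fun F F' : {set iter_powerset (grid n R) j'} =>
      [exists G' in F', [forall G in F, ltS S G G']]
  end.

Definition S_increasing (k n R S : nat)
    (t : seq (iter_powerset (grid n R) (k - 2))) : bool :=
  pairwise (@ltS n R S (k - 2)) t.

(* For [0 < S] an S-increasing sequence has no repetition, so its length is at
   most the cardinality of the iterated power set, and restricting the maximum
   to such lengths loses nothing: see [max_increasing_ub]. *)
Definition max_increasing (k n R S : nat) : nat :=
  \max_(l < #|iter_powerset (grid n R) (k - 2)|.+1
        | [exists t : l.-tuple (iter_powerset (grid n R) (k - 2)),
             S_increasing S t]) l.

Lemma ltS_irreflexive n R S j : 0 < S -> irreflexive (@ltS n R S j).
Proof.
move=> S_gt0; elim: j => [|j IHj] x /=.
  rewrite (_ : [set l | _] = set0) ?cards0 ?leqn0 -?lt0n ?S_gt0 //.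
    by apply: negbTE; rewrite -lt0n.
  by apply/setP=> l; rewrite !inE ltnn.
apply/negbTE/existsP=> -[G /andP[xG /forallP/(_ G)]].
by rewrite xG IHj.
Qed.

Lemma S_increasing_uniq k n R S t :
  0 < S -> @S_increasing k n R S t -> uniq t.
Proof.
by move=> S_gt0; apply: pairwise_uniq; apply: ltS_irreflexive.
Qed.

Lemma max_increasing_ub k n R S t :
  0 < S -> @S_increasing k n R S t -> size t <= max_increasing k n R S.
Proof.
move=> S_gt0 inc_t.
have lt_t : size t < #|iter_powerset (grid n R) (k - 2)|.+1.
  by rewrite ltnS -(card_uniqP (S_increasing_uniq S_gt0 inc_t)) max_card.
apply: (bigmax_sup (Ordinal lt_t)) => //=.
by apply/existsP; exists (in_tuple t).
Qed.

Lemma max_increasing_attained k n R S :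
  exists2 t, @S_increasing k n R S t & size t = max_increasing k n R S.
Proof.
rewrite /max_increasing; apply: (big_ind (fun m =>
  exists2 t, @S_increasing k n R S t & size t = m)).
- by exists [::].
- by move=> x y hx hy; rewrite /maxn; case: ifP.
- by move=> l /existsP[t inc_t]; exists t => //; rewrite size_tuple.
Qed.

(* Main.v *)
(** Increasing (k-1)-tuples of vertices are shifted along the edges of a tight
    path. For the upper bound, send such a tuple to the vector indexed by the
    s-sets B of colors whose B-th entry is the length of the longest tight path
    ending at the tuple with all its colors in B. Shifting along an edge of
    color a increases the C(r-1, s-1) entries with a in B. Passing from a map f
    on (p+1)-tuples to w |-> { f (x w) | x < min w } trades one vertex for one
    power set; after k-2 steps the vertices themselves carry an S-increasing
    sequence. For the lower bound this is undone: choosing the witnesses of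
    F < F' turns an S-increasing sequence into a map on (k-1)-tuples with values
    in [n]^R. For s in {1, r-1} we have R = r, and an edge gets a color which
    certifies increasing coordinates in such a way that a path with at most s
    colors increases a fixed coordinate at each of its n edges, whereas only n
    values are available. *)

Require Import Defs.
From mathcomp Require Import all_boot zify.

Set Implicit Arguments.
Unset Strict Implicit.
Unset Printing Implicit Defensive.

(** * Increasing sequences of vertices and their windows *)

Definition increasing N (s : seq 'I_N) : bool :=
  sorted (fun x y : 'I_N => x < y) s.

(** The two arguments of [F] are the consecutive windows of [q.+1] vertices in a set of [q.+2];
    values of [F] elsewhere are irrelevant. *)
Definition shift_increasing n R S N j (q : nat)
    (F : seq 'I_N -> iter_powerset (grid n R) j) : Prop :=
  forall x s y, size s = q -> increasing (x :: rcons s y) ->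
    ltS S (F (x :: s)) (F (rcons s y)).

Lemma ord_lt_trans N : transitive (fun x y : 'I_N => x < y).
Proof. by move=> y x z; apply: ltn_trans. Qed.

Lemma increasing_consl N (x : 'I_N) s : increasing (x :: s) -> increasing s.
Proof. exact: path_sorted. Qed.

Lemma increasing_rconsl N s (y : 'I_N) :
  increasing (rcons s y) -> increasing s.
Proof. by rewrite -cats1 => /cat_sorted2[]. Qed.

Lemma increasing_set_inj N (s t : seq 'I_N) :
  increasing s -> increasing t -> s =i t -> s = t.
Proof.
move=> inc_s inc_t; apply: irr_sorted_eq inc_s inc_t; first exact: ord_lt_trans.
by move=> x; rewrite /= ltnn.
Qed.

Lemma increasing_enum N (A : {pred 'I_N}) : increasing (enum A).
Proof.
rewrite /increasing /enum_mem; apply: sorted_filter; first exact: ord_lt_trans.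
have := iota_ltn_sorted 0 N; rewrite -val_enum_ord enumT.
by rewrite (sorted_map (f := val) (e' := ltn)).
Qed.

Lemma enum_increasing N (s : seq 'I_N) :
  increasing s -> enum [set x in s] = s.
Proof.
move=> inc_s; apply: increasing_set_inj (increasing_enum _) inc_s _ => x.
by rewrite mem_enum inE.
Qed.

Lemma increasing_map_iota N (u : nat -> 'I_N) m p b :
  (forall i j, i < j < b -> u i < u j) -> m + p <= b ->
  increasing [seq u j | j <- iota m p].
Proof.
move=> u_mono le_b; apply/(sortedP (u 0)) => i; rewrite size_map size_iota.
move=> lt_i; rewrite !(nth_map 0) ?size_iota ?(ltnW lt_i) //.
rewrite !nth_iota ?(ltnW lt_i) //; apply: u_mono.
by rewrite ltn_add2l ltnSn /= (leq_trans _ le_b) // ltn_add2l.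
Qed.

Lemma tight_edge_seq N b (v : 'I_b -> 'I_N) (u : nat -> 'I_N) i k :
  (forall j : 'I_b, u j = v j) -> i + k <= b ->
  [set v j | j : 'I_b & i <= j < i + k] = [set x in [seq u j | j <- iota i k]].
Proof.
move=> uv le_b; apply/setP => x; rewrite !inE; apply/imsetP/mapP => -[j].
  by rewrite inE => ij ->; exists (val j); rewrite ?uv // mem_iota.
rewrite mem_iota => ij ->; have lt_j : j < b.
  by case/andP: ij => _ /leq_trans; apply.
by exists (Ordinal lt_j); rewrite ?inE // -uv.
Qed.

(** * Trading vertices for power sets, in both directions *)

Section Lift.

Context {n R S N : nat}.

Fixpoint lift_powerset (f : seq 'I_N -> grid n R) (j : nat) :
    seq 'I_N -> iter_powerset (grid n R) j :=
  match j return seq 'I_N -> iter_powerset (grid n R) j with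
  | 0 => f
  | j'.+1 => fun s =>
      [set lift_powerset f j' (x :: s) | x : 'I_N & increasing (x :: s)]
  end.

Lemma lift_powerset_shift_increasing f j q :
  @shift_increasing n R S N 0 (q + j) f ->
  shift_increasing S q (lift_powerset f j).
Proof.
elim: j q => [|j IHj] q; first by rewrite addn0.
rewrite addnS -addSn => /IHj {}IHj x s y sz_s inc_s /=.
(* One witness serves all [z]: each [z :: x :: s] shifts to this same tuple. *)
apply/existsP; exists (lift_powerset f j (x :: rcons s y)).
rewrite imset_f ?inE //=; apply/forallP => G; apply/implyP => /imsetP[z].
rewrite inE => inc_z ->; apply: (IHj z (x :: s) y); rewrite /= ?sz_s //.
by move: inc_z inc_s; rewrite /increasing /= => /andP[-> _].
Qed.

(** The witness for [F (x :: s)] below [F (rcons s y)] depends only on [x :: rcons s y], so choosing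
    it gives a map [h] on tuples with one more vertex. *)
Lemma shift_increasing_descend (d : grid n R) j q F :
  @shift_increasing n R S N j q F ->
  exists f : seq 'I_N -> grid n R, @shift_increasing n R S N 0 (q + j) f.
Proof.
elim: j q F => [|j IHj] q F incF; first by exists F; rewrite addn0.
have d' : iter_powerset (grid n R) j.
  by case: (j) => [|i]; [exact: d | exact: set0].
pose h w := if w is x :: w' then
    odflt d' [pick G' in F w' | [forall G in F (belast x w'), ltS S G G']]
  else d'.
have hP x s y : size s = q -> increasing (x :: rcons s y) ->
    h (x :: rcons s y) \in F (rcons s y) /\
    (forall G, G \in F (x :: s) -> ltS S G (h (x :: rcons s y))).
  move=> sz_s inc_s; rewrite /h belast_rcons.
  case: pickP => [G' /andP[FG' /forallP ltG'] | none] /=.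
    by split=> // G; apply/implyP.
  have /existsP[G'] := incF x s y sz_s inc_s.
  by rewrite none.
have inc_h : shift_increasing S q.+1 h.
  move=> x s y sz_s inc_s; case/lastP: s => [|s z] // in sz_s inc_s *.
  move: sz_s; rewrite size_rcons => -[sz_s].
  (* The earlier witness is an element of [F (rcons s z)], all of whose elements lie below the next
     witness. *)
  have [Fh _] := hP x s z sz_s (@increasing_rconsl _ (x :: rcons s z) y inc_s).
  case s_eq: (rcons s z) inc_s Fh => [|x' s'] inc_s Fh; first by case: (s) s_eq.
  have sz_s' : size s' = q.
    by apply: succn_inj; rewrite -sz_s -(size_rcons s z) s_eq.
  exact: (hP x' s' y sz_s' (increasing_consl inc_s)).2.
by have [f incf] := IHj _ _ inc_h; exists f; rewrite addnS -addSn.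
Qed.

End Lift.

(* Here [k - 2] is spelled as in [S_increasing]: it does not reduce to [q] for
   [k = q.+2]. *)
Lemma shift_increasing_S_increasing k n R S N F :
  @shift_increasing n R S N (k - 2) 0 F ->
  S_increasing S [seq F [:: x] | x <- enum 'I_N].
Proof.
move=> incF; rewrite /S_increasing pairwise_map.
have : pairwise (fun x y : 'I_N => x < y) (enum 'I_N).
  rewrite -sorted_pairwise; [exact: increasing_enum | exact: ord_lt_trans].
apply: sub_pairwise => x y lt_xy.
by apply: (incF x [::] y); rewrite // /increasing /= lt_xy.
Qed.

(** * Tight paths with all colors in a prescribed set *)

Section Reach.

Context {N r : nat} (c : {set 'I_N} -> 'I_r) (B : {set 'I_r}).

(* [reach L s]: some tight path with L edges, all colored in B, ends with the
   vertices s, where [size s].+1 is the uniformity. *)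
Fixpoint reach (L : nat) (s : seq 'I_N) : bool :=
  if L is L'.+1 then
    [exists x, [&& increasing (x :: s), c [set y in x :: s] \in B
                 & reach L' (belast x s)]]
  else true.

Lemma reach_rcons L x s y :
  increasing (x :: rcons s y) -> c [set z in x :: rcons s y] \in B ->
  reach L (x :: s) -> reach L.+1 (rcons s y).
Proof.
move=> inc_s cB rs; apply/existsP; exists x.
by rewrite belast_rcons; apply/and3P.
Qed.

Lemma reach_path L s : 0 < size s -> increasing s -> reach L s ->
  exists t, [/\ size t = L, increasing (t ++ s)
    & forall i, i < L ->
        c [set y in take (size s).+1 (drop i (t ++ s))] \in B].
Proof.
elim: L s => [|L IHL] s s_gt0 inc_s; first by exists [::].
case/existsP=> x /and3P[inc_xs cB].
case/lastP: s => // s y in s_gt0 inc_s inc_xs cB *.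
rewrite belast_rcons => /(IHL (x :: s) isT).
case=> [|t [sz_t inc_t ct]]; first exact: (@increasing_rconsl _ (x :: s) y).
exists (rcons t x); rewrite size_rcons sz_t cat_rcons; split=> // [|i].
  move: inc_t inc_xs; rewrite /increasing; case: t {sz_t ct} => //= z t.
  by rewrite !cat_path /= => /and3P[-> -> _].
(* Index [L] is the new last edge; earlier windows stop before [y] and come from the induction
   hypothesis. *)
rewrite ltnS leq_eqVlt => /predU1P[-> | lt_i].
  by rewrite drop_size_cat // size_rcons take_oversize //= size_rcons.
have := ct i lt_i; rewrite -rcons_cons -rcons_cat size_rcons !take_drop.
rewrite -[rcons _ y]cats1 (takel_cat [:: y]) //.
by rewrite size_cat sz_t /=; lia.
Qed.

End Reach.

Lemma reach_tight_path n q N r (c : {set 'I_N} -> 'I_r) B s :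
  size s = q.+1 -> increasing s -> reach c B n s ->
  exists v : 'I_(n + q.+2 - 1) -> 'I_N,
    (forall i j : 'I_(n + q.+2 - 1), i < j -> v i < v j) /\
    [set c e | e in tight_path_edges v] \subset B.
Proof.
move=> sz_s inc_s /reach_path[||t [sz_t inc_t ct]]; rewrite ?sz_s //.
have x0 : 'I_N by case: s sz_s {inc_s inc_t ct}.
have sz_ts : size (t ++ s) = n + q.+2 - 1.
  by rewrite size_cat sz_t sz_s; lia.
exists (fun j => nth x0 (t ++ s) j); split=> [i j lt_ij|].
  apply: (sorted_ltn_nth (@ord_lt_trans N) x0 inc_t) => //;
    by rewrite inE sz_ts ltn_ord.
apply/subsetP => _ /imsetP[e /imsetP[i _ ->] ->].
have le_i : i + q.+2 <= n + q.+2 - 1.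
  by case: i => i /=; lia.
rewrite (tight_edge_seq (u := nth x0 (t ++ s))) //.
by rewrite map_nth_iota ?sz_ts -?sz_s ?ct //; lia.
Qed.

(** By Pascal's rule: the sets avoiding [a] are the draws from its complement, and cancelling them
    leaves the claim. *)
Lemma card_draws_mem (T : finType) (a : T) s :
  #|[set B : {set T} | (#|B| == s.+1) && (a \in B)]| = 'C(#|T|.-1, s).
Proof.
have T_gt0 : 0 < #|T| by apply/card_gt0P; exists a.
have := card_draws T s.+1; rewrite -{1}(prednK T_gt0) binS.
pose without_a := [set B : {set T} | (#|B| == s.+1) && (a \notin B)].
have -> : 'C(#|T|.-1, s.+1) = #|without_a|.
  rewrite -(cardsC1 a) -cards_draws; apply: eq_card => B.
  by rewrite !inE andbC subsetC sub1set inE.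
rewrite -(cardsID [set B : {set T} | a \in B]) addnC.
rewrite [X in X + _](_ : _ = #|without_a|).
  by move/addnI <-; apply: eq_card => B; rewrite !inE.
by apply: eq_card => B; rewrite !inE andbC.
Qed.

Lemma draws_indexing r s :
  exists B : 'I_('C(r, s.+1)) -> {set 'I_r},
    (forall l, #|B l| = s.+1) /\
    (forall a, #|[set l | a \in B l]| = 'C(r.-1, s)).
Proof.
rewrite -[in 'C(r, _)](card_ord r) -card_draws.
exists (@enum_val _ (mem [set B : {set 'I_r} | #|B| == s.+1])); split=> [l|a].
  by apply/eqP; have := enum_valP l; rewrite inE.
rewrite -[in RHS](card_ord r) -(card_draws_mem a) -(card_imset _ enum_val_inj).
apply: eq_card => B; rewrite inE; apply/imsetP/andP => [[l + ->]|[sz_B aB]].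
  by rewrite inE => ->; have := enum_valP l; rewrite inE => ->.
have DB : B \in [set B : {set 'I_r} | #|B| == s.+1] by rewrite inE.
by exists (enum_rank_in DB B); rewrite ?inE enum_rankK_in.
Qed.

(** * The upper bound *)

Lemma tight_path_or_S_increasing k n r s N (c : {set 'I_N} -> 'I_r) :
  2 <= k -> 0 < n ->
  (exists v : 'I_(n + k - 1) -> 'I_N,
     (forall i j : 'I_(n + k - 1), i < j -> v i < v j) /\
     #|[set c e | e in tight_path_edges v]| <= s.+1) \/
  (exists2 t, @S_increasing k n 'C(r, s.+1) 'C(r.-1, s) t & size t = N).
Proof.
case: k => [|[|q]] // _; case: n => // n _.
have [B [card_B card_mem_B]] := draws_indexing r s.
have [/existsP[l /existsP[t /andP[inc_t rt]]]|no_path] := boolP [exists l,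
    exists t : q.+1.-tuple 'I_N, increasing t && reach c (B l) n.+1 t].
  have [v [v_mono cB]] := reach_tight_path (size_tuple t) inc_t rt.
  by left; exists v; split=> //; rewrite -(card_B l) subset_leq_card.
(* Length 0 is always reached, so the maximum is over a nonempty set. *)
pose f (t : seq 'I_N) : grid n.+1 'C(r, s.+1) :=
  [ffun l => [arg max_(L > ord0 | reach c (B l) (L : 'I_n.+1) t) L]].
have inc_f : @shift_increasing n.+1 _ 'C(r.-1, s) _ 0 (0 + (q.+2 - 2)) f.
  rewrite !subSS subn0 => x t y sz_t inc_t /=.
  rewrite -(card_mem_B (c [set z in x :: rcons t y])); apply: subset_leq_card.
  apply/subsetP => l; rewrite !inE !ffunE => cB.
  case: arg_maxnP => // L /(reach_rcons inc_t cB) rL _.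
  (* Otherwise the extended path has the full [n.+1] edges, against [no_path]; so [L.+1] is still a
     legal coordinate. *)
  have lt_L : L.+1 < n.+1.
    rewrite ltn_neqAle ltn_ord andbT; apply: contraNneq no_path => eq_L.
    have sz_ty : size (rcons t y) == q.+1 by rewrite size_rcons sz_t.
    apply/existsP; exists l; apply/existsP; exists (Tuple sz_ty).
    by rewrite -eq_L rL andbT (increasing_consl inc_t).
  by case: arg_maxnP => // L' _ /(_ (Ordinal lt_L)); apply.
right; exists [seq lift_powerset f (q.+2 - 2) [:: x] | x <- enum 'I_N].
  apply: shift_increasing_S_increasing.
  exact: lift_powerset_shift_increasing.
by rewrite size_map size_enum_ord.
Qed.

Lemma forces_path_max_increasing k n r s :
  2 <= k -> 0 < n -> s < r ->
  forces_path k n r s.+1 (max_increasing k n 'C(r, s.+1) 'C(r.-1, s)).+1.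
Proof.
move=> k_ge2 n_gt0 lt_sr c.
have [// | [t inc_t sz_t]] := tight_path_or_S_increasing s c k_ge2 n_gt0.
have S_gt0 : 0 < 'C(r.-1, s) by rewrite bin_gt0 -ltnS (ltn_predK lt_sr).
by have := max_increasing_ub S_gt0 inc_t; rewrite sz_t ltnn.
Qed.

(** * The lower bound for extreme [s] *)

Lemma tight_edge_window n q (N : nat) (v : 'I_(n + q.+2 - 1) -> 'I_N) :
  (forall i j : 'I_(n + q.+2 - 1), i < j -> v i < v j) -> 0 < n ->
  exists u : nat -> 'I_N,
    (forall i j, i < j < n + q.+1 -> u i < u j) /\
    forall i, i < n ->
      [set x in [seq u j | j <- iota i q.+2]] \in tight_path_edges v.
Proof.
move=> v_mono n_gt0.
have lt_0 : 0 < n + q.+2 - 1 by lia.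
pose u j := v (insubd (Ordinal lt_0) j).
have uv (j : 'I_(n + q.+2 - 1)) : u j = v j by rewrite /u valKd.
exists u; split=> [i j ij | i lt_i].
  by apply: v_mono; rewrite !val_insubd; do 2 (case: ifP; try lia).
rewrite -(tight_edge_seq uv); last by lia.
by apply/imsetP; exists (Ordinal lt_i).
Qed.

(* [inc a] is the set of coordinates that color [a] certifies as increasing. *)
Lemma not_forces_path k n r s R S N (inc : 'I_r -> {set 'I_R}) :
  2 <= k -> 0 < n -> 0 < r ->
  (forall X : {set 'I_R}, S <= #|X| -> exists a, inc a \subset X) ->
  (forall C : {set 'I_r}, #|C| <= s ->
     exists l, forall a, a \in C -> l \in inc a) ->
  N <= max_increasing k n R S -> ~ forces_path k n r s N.
Proof.
case: k => [|[|q]] // _ n_gt0 r_gt0 incS incC le_N forces.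
have [t inc_t sz_t] := max_increasing_attained q.+2 n R S.
have d : grid n R := [ffun=> Ordinal n_gt0].
have x0 : iter_powerset (grid n R) (q.+2 - 2).
  by rewrite !subSS subn0; case: (q) => [|j]; [exact: d | exact: set0].
pose F (w : seq 'I_N) := if w is x :: _ then nth x0 t (x : 'I_N) else x0.
have incF : shift_increasing S 0 F.
  move=> x [|//] y _ /=; rewrite /increasing /= andbT => lt_xy.
  apply: (pairwiseP x0 inc_t) => //; rewrite inE sz_t.
    exact: leq_trans (ltn_ord x) le_N.
  exact: leq_trans (ltn_ord y) le_N.
have [f incf] := shift_increasing_descend d incF.
rewrite !subSS subn0 add0n in incf.
pose X w := if w is x :: w' then [set l | f (belast x w') l < f w' l] else set0.
have X_window x w y : size w = q -> increasing (x :: rcons w y) ->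
    exists a, inc a \subset X (x :: rcons w y).
  by move=> sz_w inc_w; apply: incS; rewrite /X belast_rcons; apply: incf.
(* By [X_window] the default color can occur only on sets without exactly [q.+2] elements. *)
pose c (e : {set 'I_N}) : 'I_r :=
  odflt (Ordinal r_gt0) [pick a | inc a \subset X (enum e)].
have [v [v_mono /incC[l incl]]] := forces c.
have [u [u_mono u_edge]] := tight_edge_window v_mono n_gt0.
have window i : i < n ->
    f [seq u j | j <- iota i q.+1] l < f [seq u j | j <- iota i.+1 q.+1] l.
  move=> lt_i; have inc_i : increasing [seq u j | j <- iota i q.+2].
    by apply: increasing_map_iota u_mono _; lia.
  have := incl _ (imset_f c (u_edge i lt_i)).
  rewrite /c enum_increasing //.
  have iotaS : iota i.+1 q.+1 = rcons (iota i.+1 q) (i + q.+1).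
    by rewrite -cats1 -[q.+1 in LHS]addn1 iotaD /= addSnnS.
  have windowS : [seq u j | j <- iota i q.+2] =
      u i :: rcons [seq u j | j <- iota i.+1 q] (u (i + q.+1)).
    by rewrite -map_rcons -iotaS.
  rewrite windowS in inc_i *.
  case: pickP => [a /subsetP subX /subX | none].
    by rewrite inE belast_rcons -map_rcons -iotaS.
  have [|a] := X_window _ _ _ _ inc_i; first by rewrite size_map size_iota.
  by rewrite none.
(* After [n] strict increases coordinate [l] would be at least [n], outside ['I_n]. *)
have le_i i : i <= n -> i <= f [seq u j | j <- iota i q.+1] l.
  elim: i => // i IHi lt_i.
  exact: leq_ltn_trans (IHi (ltnW lt_i)) (window i lt_i).
by have := le_i n (leqnn n); rewrite leqNgt ltn_ord.
Qed.

(** Finite functions make the forcing property decidable, so a least [N] can be extracted. *)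
Lemma forces_path_is_A k n r s M :
  forces_path k n r s M -> exists2 A, is_A k n r s A & A <= M.
Proof.
pose forces N := [forall c : {ffun {set 'I_N} -> 'I_r},
  exists v : {ffun 'I_(n + k - 1) -> 'I_N},
    [forall i : 'I_(n + k - 1), forall j : 'I_(n + k - 1),
       (i < j) ==> (v i < v j)] &&
    (#|[set c e | e in tight_path_edges v]| <= s)].
have forcesP N : reflect (forces_path k n r s N) (forces N).
  apply: (iffP forallP) => [path_c c | path_c c].
    have /existsP[v /andP[/forallP v_mono le_s]] := path_c (finfun c).
    exists v; split=> [i j lt_ij|].
      by have /forallP/(_ j)/implyP := v_mono i; apply.
    by under eq_imset => e do rewrite -(ffunE c).
  have [v [v_mono le_s]] := path_c c.
  apply/existsP; exists (finfun v); apply/andP; split.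
    apply/forallP => i; apply/forallP => j; apply/implyP => lt_ij.
    by rewrite !ffunE v_mono.
  rewrite (_ : tight_path_edges _ = tight_path_edges v) //.
  by apply: eq_imset => i; apply: eq_imset => j; rewrite ffunE.
move=> /forcesP forces_M; have ex_A : exists N, forces N by exists M.
case: (ex_minnP ex_A) => A /forcesP forces_A min_A.
by exists A; [split=> // N /forcesP /min_A | apply: min_A].
Qed.

Theorem theorem5p3 (k n r s : nat)
    (hk : 2 <= k) (hkn : k <= n) (hs : 1 <= s) (hsr : s < r) :
  exists A : nat,
    is_A k n r s A /\
    A <= max_increasing k n 'C(r, s) 'C(r - 1, s - 1) + 1 /\
    (s = 1 \/ s = r - 1 ->
       max_increasing k n 'C(r, s) 'C(r - 1, s - 1) < A).
Proof.
have n_gt0 : 0 < n by lia.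
have r_gt0 : 0 < r by lia.
have forces : forces_path k n r s
    (max_increasing k n 'C(r, s) 'C(r - 1, s - 1)).+1.
  case: s hs hsr => // s _ lt_sr; rewrite subSS subn0 subn1.
  by apply: forces_path_max_increasing; lia.
have [A is_A_A le_A] := forces_path_is_A forces.
exists A; split=> //; split=> [|s_extreme]; first by rewrite addn1.
rewrite ltnNge; apply/negP => le_A'; case: is_A_A => forces_A _.
case: s_extreme => s_eq; subst s.
  move: le_A'; rewrite bin1 subnn bin0 => le_A'.
  (* For [s = 1] one increasing coordinate is required, and the color names it. *)
  apply: (not_forces_path (inc := set1)) le_A' forces_A => // [X|C].
    by case/card_gt0P=> a aX; exists a; rewrite sub1set.
  have [->|[a aC]] := set_0Vmem C.
    by exists (Ordinal r_gt0) => a; rewrite inE.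
  by move/card_le1_eqP => C1; exists a => b bC; rewrite inE (C1 a b).
case: r hs hsr r_gt0 forces {le_A} le_A' forces_A => [//|[|r]] // _ _ _ _.
rewrite subn1 /= subn1 /= !binSn => le_A' forces_A.
(* For [s = r - 1] at most one coordinate fails to increase, and the color names it. A color [l]
   missing from the path then gives a coordinate increasing at every edge. *)
apply: (not_forces_path (inc := fun a => [set~ a])) le_A' forces_A => // [X|C].
  move=> le_X; have /card_le1_eqP XC1 : #|~: X| <= 1.
    by move: (cardsC X); rewrite card_ord; lia.
  have [XC0|[a aX]] := set_0Vmem (~: X); last first.
    exists a; apply/subsetP => b; rewrite !inE => neq_ba.
    by apply: contraNT neq_ba => bX; rewrite (XC1 b a _ aX) ?inE.
  by exists ord0; rewrite -(setCK X) XC0 setC0 subsetT.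
move=> le_C; have /card_gt0P[l] : 0 < #|~: C|.
  by move: (cardsC C); rewrite card_ord; lia.
rewrite inE => lC; exists l => a aC; rewrite !inE.
by apply: contraNneq lC => ->.
Qed.
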